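(* Consider a heavy convex rigid body with smooth surface that rolls without slipping on a horizontal plane rotating with constant angular velocity $\kappa e_3$, $\kappa\neq0$. If a motion of the rolling body is unbounded (i.e. the position $x(t)$ of the center of mass is unbounded for $t\ge0$), then its angular velocity $\Omega$ satisfies $\limsup_{t\to\infty}\|\Omega(t)\|=\infty$.
   Context: Setting. $\Sigma_s=\{O;e_1,e_2,e_3\}$ is an inertial frame; the plane is the one spanned by $e_1,e_2$ through $O$, rotating about $e_3$ with constant angular velocity $\kappa e_3$; $e_3^s=(0,0,1)^T$. $x=(x_1,x_2,x_3)$ are the coordinates in $\Sigma_s$ of the center of mass $C$ of the body. $g\in\mathrm{SO}(3)$ is the attitude matrix: representatives of a vector in $\Sigma_s$ and in a body frame with origin $C$ are related by $u^s=gu^b$. The configuration manifold is $Q=\mathbb{R}^2\times\mathrm{SO}(3)\ni(q,g)$, $q=(x_1,x_2)$. $\Omega\in\mathbb{R}^3$ is the body representative of the angular velocity ($\dot g=g\hat\Omega$, $\hat\Omega a=\Omega\times a$), and $TQ$ is left-trivialized with coordinates $(q,g,\dot q,\Omega)$. $\gamma=\gamma(g)=g^{-1}e_3^s\in S^2$ is the Poisson vector; $\rho=\rho(g)$ is the body representative of the vector $PC$, with $P$ the point of the body in contact with the plane. The surface $\mathcal{S}$ of the body (in the body frame) is smooth and convex with Gauss map (outward unit normal) $G:\mathcal{S}\to S^2$ a diffeomorphism, and $\rho=F(\gamma)$ with $F(\gamma)=-G^{-1}(-\gamma)$. The holonomic constraint of contact is $x_3=\gamma\cdot\rho$, and then $\dot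 x_3=\gamma\cdot(\Omega\times\rho)$. $Q$ is identified with its image in $\mathbb{R}^3\times\mathrm{SO}(3)\ni(x,g)$ via $x=(q_1,q_2,\gamma\cdot\rho)$. $m>0$ is the mass, $\mathcal{G}$ the gravitational acceleration, $\mathbb{I}$ the (positive definite) inertia tensor relative to the center of mass. The Lagrangian is $L=\frac12\mathbb{I}\Omega\cdot\Omega+\frac m2\big(\dot q_1^2+\dot q_2^2+(\gamma\cdot[\Omega\times\rho])^2\big)-m\mathcal{G}\gamma\cdot\rho$. The no-slipping constraint is $\dot x=g(\Omega\times\rho)+\kappa e_3^s\times(x-g\rho)$; it defines the constraint manifold $M\subset TQ$, $M\cong\mathbb{R}^2\times\mathrm{SO}(3)\times\mathbb{R}^3\ni(q,g,\Omega)$, and the associated distribution $\mathcal{D}_{(q,g)}=\{(g(\Omega\times\rho),\Omega):\Omega\in\mathbb{R}^3\}$ (tangent vectors written as pairs $(\dot x,\Omega)$). The motions are the solutions of the nonholonomic equations with ideal constraints (d'Alembert principle: the Lagrange equations of $L$ with a reaction force on the right-hand side that annihilates $\mathcal{D}$, restricted to $M$). Equivalently, $m\ddot x=-m\mathcal{G}e_3^s+R_1$, $\frac{d}{dt}(\mathbb{I}\Omega)=\mathbb{I}\Omega\times\Omega+R_2$, $\dot g=g\hat\Omega$, with the constraint and with $(R_1,R_2)$ annihilating $\mathcal{D}$, i.e. $R_2=(g^{-1}R_1)\times\rho$. *)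

(* Defs.v *)
From HB Require Import structures.
From mathcomp Require Import all_boot all_order all_algebra.
From mathcomp Require Import all_classical all_reals all_analysis.

Set Implicit Arguments.
Unset Strict Implicit.
Unset Printing Implicit Defensive.

Import Order.TTheory GRing.Theory Num.Theory.
Import numFieldNormedType.Exports.

Local Open Scope classical_set_scope.
Local Open Scope ring_scope.

Section Euclidean3.
Variable R : realType.
Implicit Types u v w : 'cV[R]_3.

Definition dot u v : R := \sum_i u i 0 * v i 0.

(* The library norm on matrices is the sup norm. *)
Definition enorm u : R := Num.sqrt (dot u u).

(* Indices are added modulo 3 (ring structure of 'I_3). *)
Definition cross u v : 'cV[R]_3 :=
  \col_(i < 3) (u (i + 1) 0 * v (i + 2%:R) 0 - u (i + 2%:R) 0 * v (i + 1) 0).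

(* hat w *m u = cross w u *)
Definition hat w : 'M[R]_3 :=
  \matrix_(i < 3, j < 3) cross w (delta_mx j 0) i 0.

Definition e3 : 'cV[R]_3 := delta_mx (2%:R : 'I_3) 0.

Definition SO3 : set 'M[R]_3 := [set g | g^T *m g = 1%:M /\ \det g = 1].

Definition sphere : set 'cV[R]_3 := [set u | enorm u = 1].

Definition posdef (A : 'M[R]_3) : Prop :=
  A^T = A /\ forall u, u != 0 -> 0 < dot u (A *m u).

End Euclidean3.

Section Smoothness.
Variables (R : realType) (V W : normedModType R).

(* In finite dimension this is the usual class C^k on an open set U. *)
Fixpoint Ck (k : nat) (U : set V) (f : V -> W) : Prop :=
  match k with
  | 0 => forall x, U x -> {for x, continuous f}
  | k'.+1 => (forall x, U x -> differentiable f x) /\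
             forall v, Ck k' U (fun x => 'D_v f x)
  end.

Definition smooth (U : set V) (f : V -> W) : Prop := forall k, Ck k U f.

(* Smoothness on an arbitrary subset, e.g. a surface, by local extension. *)
Definition smooth_on (A : set V) (f : V -> W) : Prop :=
  forall p, A p -> exists (U : set V) (f' : V -> W),
    [/\ open U, U p, smooth U f' & forall y, A y -> U y -> f y = f' y].

End Smoothness.

Section ConvexSurface.
Variable R : realType.
Implicit Types (K U : set 'cV[R]_3) (p n : 'cV[R]_3) (h : 'cV[R]_3 -> R).

Definition boundary K : set 'cV[R]_3 := closure K `\` K°.

Definition grad h p : 'cV[R]_3 := \col_(i < 3) 'D_(delta_mx i 0) h p.

(* Near p, K is the sublevel set h <= 0 of a smooth function without critical
   point at p; grad h p then points out of K. *)
Definition local_defining_function K p U h : Prop :=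
  [/\ open U, U p, smooth U h, grad h p != 0 &
      forall y, U y -> (K y <-> h y <= 0)].

Definition smooth_convex_body K : Prop :=
  [/\ compact K, convex_set K, K° !=set0 &
      forall p, boundary K p -> exists U h, local_defining_function K p U h].

Definition is_Gauss_map K (G : 'cV[R]_3 -> 'cV[R]_3) : Prop :=
  forall p U h, boundary K p -> local_defining_function K p U h ->
    G p = (enorm (grad h p))^-1 *: grad h p.

(* f restricts to a diffeomorphism of A onto B with inverse f'; the values of
   f off A and of f' off B are irrelevant. *)
Definition diffeomorphism (A B : set 'cV[R]_3)
    (f f' : 'cV[R]_3 -> 'cV[R]_3) : Prop :=
  [/\ smooth_on A f /\ smooth_on B f',
      forall p, A p -> B (f p),
      forall n, B n -> A (f' n),
      forall p, A p -> f' (f p) = p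
    & forall n, B n -> f (f' n) = n].

End ConvexSurface.

Section RollingBody.
Variable R : realType.
Variable Ginv : 'cV[R]_3 -> 'cV[R]_3.
Implicit Types (g : 'M[R]_3) (x w : 'cV[R]_3).

Definition gamma g : 'cV[R]_3 := invmx g *m e3 R.

(* The contact point has outward normal - gamma, and rho points from it to the
   center of mass, which is the origin of the body frame. *)
Definition rho g : 'cV[R]_3 := - Ginv (- gamma g).

(* No slipping: the material point of the body at the contact point
   x - g rho has the velocity of the plane, which turns about e3 at rate kappa. *)
Definition rolling_velocity (kappa : R) x g w : 'cV[R]_3 :=
  g *m cross w (rho g) + kappa *: cross (e3 R) (x - g *m rho g).

(* (R1, R2) annihilates the distribution {(g (w x rho), w)} at g. *)
Definition ideal_reaction g (R1 R2 : 'cV[R]_3) : Prop :=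
  forall w, dot R1 (g *m cross w (rho g)) + dot R2 w = 0.

(* Newton-Euler form of d'Alembert's principle: gravity and the inertial terms
   are balanced by a reaction (force R1 in the inertial frame, moment R2 in the
   body frame) that annihilates the constraint distribution. *)
Record is_motion (m grav kappa : R) (II : 'M[R]_3) (J : interval R)
    (x : R -> 'cV[R]_3) (g : R -> 'M[R]_3) (Om : R -> 'cV[R]_3) : Prop := {
  motion_attitude : forall t, t \in J -> SO3 (g t);
  motion_contact : forall t, t \in J ->
    x t (2%:R : 'I_3) 0 = dot (gamma (g t)) (rho (g t));
  motion_kinematics : forall t, t \in J ->
    is_derive t (1 : R) g (g t *m hat (Om t));
  motion_rolling : forall t, t \in J ->
    is_derive t (1 : R) x (rolling_velocity kappa (x t) (g t) (Om t));
  motion_dynamics : forall t, t \in J ->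
    exists R1 R2 : 'cV[R]_3,
      [/\ ideal_reaction (g t) R1 R2,
          derivable (derive1 x) t (1 : R),
          derivable Om t (1 : R),
          m *: derive1 (derive1 x) t = - (m * grav) *: e3 R + R1
        & derive1 (fun s => II *m Om s) t = cross (II *m Om t) (Om t) + R2]
}.

End RollingBody.

(* Main.v *)
Require Import Defs.
From mathcomp Require Import all_boot all_order all_algebra.
From mathcomp Require Import all_classical all_reals all_analysis.
From mathcomp Require Import ring lra.

(** Seen from the rotating plane the no-slip condition is linear and the
    motion has a conserved energy. In inertial terms this moving energy is
      [E - kappa * L3],
    the total energy minus [kappa] times the vertical angular momentum about
    the fixed point [O] of the plane; in general neither term is conserved by
    itself. The reaction [(R1, R2)] changes [E] at the rate
    [dot R1 x' + dot R2 Om], because [x'] contains the velocity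
    [kappa * cross e3 (x - g rho)] of the plane, and it changes [L3] at the rate
    [dot R1 (cross e3 x) + dot R2 gamma]. Since
      [x' = g (cross (Om - kappa gamma) rho) + kappa * cross e3 x],
    the first rate minus [kappa] times the second is the power of the reaction
    on the velocity [(g (cross w rho), w)] with [w = Om - kappa gamma]. This
    velocity belongs to the constraint distribution, so that power vanishes
    ([ideal_power], [moving_energy_conserved]).

    On the constraint manifold, completing the square turns the moving energy
    into
      [(dot (II Om) Om + m |cross (Om - kappa gamma) rho|^2) / 2 + m grav x3
       - kappa dot (II Om) gamma - m kappa^2 (x1^2 + x2^2) / 2]
    ([moving_energy_rolling]): the position enters only through the height
    [x3 = dot gamma rho] and the centrifugal term, whose coefficient is not
    zero. As [rho] is bounded, the body being compact, a bound on [Om] over a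
    set of times of the motion bounds [x1^2 + x2^2] there
    ([bounded_moving_energy]). If the limsup of [|Om|] were finite, [Om] would
    be bounded from some time on, hence so would [x]; before that time [x] is
    bounded by continuity. *)

Set Implicit Arguments.
Unset Strict Implicit.
Unset Printing Implicit Defensive.

Import Order.TTheory GRing.Theory Num.Theory.
Import numFieldNormedType.Exports.
Local Open Scope classical_set_scope.
Local Open Scope ring_scope.

(** * Vector algebra in dimension three *)

Section Algebra3.
Variable R : realType.
Implicit Types (u v w x : 'cV[R]_3) (g A : 'M[R]_3).
Local Notation e3 := (@e3 R).

Lemma ord3_cases (P : 'I_3 -> Prop) : P 0 -> P 1 -> P 2%:R -> forall i, P i.
Proof.
move=> P0 P1 P2 [[|[|[|//]]] i3].
- by rewrite (_ : Ordinal _ = 0) //; exact: val_inj.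
- by rewrite (_ : Ordinal _ = 1) //; exact: val_inj.
- by rewrite (_ : Ordinal _ = 2%:R) //; exact: val_inj.
Qed.

Lemma sum3E (F : 'I_3 -> R) : \sum_i F i = F 0 + F 1 + F 2%:R.
Proof.
rewrite !big_ord_recl big_ord0 addr0 addrA.
by congr (F _ + F _ + F _); exact: val_inj.
Qed.

Lemma dot3E u v : dot u v = u 0 0 * v 0 0 + u 1 0 * v 1 0 + u 2%:R 0 * v 2%:R 0.
Proof. exact: sum3E. Qed.

Lemma cross3E u v :
  (cross u v 0 0 = u 1 0 * v 2%:R 0 - u 2%:R 0 * v 1 0) *
  (cross u v 1 0 = u 2%:R 0 * v 0 0 - u 0 0 * v 2%:R 0) *
  (cross u v 2%:R 0 = u 0 0 * v 1 0 - u 1 0 * v 0 0).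
Proof.
have e11 : 1 + 1 = 2%:R :> 'I_3 by exact: val_inj.
have e12 : 1 + 2%:R = 0 :> 'I_3 by exact: val_inj.
have e21 : 2%:R + 1 = 0 :> 'I_3 by exact: val_inj.
have e22 : 2%:R + 2%:R = 1 :> 'I_3 by exact: val_inj.
by rewrite !mxE !add0r e11 e12 e21 e22.
Qed.

Lemma e3E i : e3 i 0 = (i == 2%:R)%:R.
Proof. by rewrite mxE eqxx andbT. Qed.

Lemma dotC u v : dot u v = dot v u.
Proof. by apply: eq_bigr => i _; rewrite mulrC. Qed.

Lemma dotDl u v w : dot (u + v) w = dot u w + dot v w.
Proof.
by rewrite /dot -big_split; apply: eq_bigr => i _; rewrite !mxE mulrDl.
Qed.

Lemma dotZl a u v : dot (a *: u) v = a * dot u v.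
Proof.
by rewrite /dot mulr_sumr; apply: eq_bigr => i _; rewrite !mxE mulrA.
Qed.

Lemma dotDr u v w : dot u (v + w) = dot u v + dot u w.
Proof. by rewrite !(dotC u) dotDl. Qed.

Lemma dotZr a u v : dot u (a *: v) = a * dot u v.
Proof. by rewrite !(dotC u) dotZl. Qed.

Lemma dot0l u : dot 0 u = 0.
Proof. by rewrite /dot big1 // => i _; rewrite mxE mul0r. Qed.

Lemma dot_mulmx (A : 'M[R]_3) u v : dot (A *m u) v = dot u (A^T *m v).
Proof.
rewrite /dot.
under eq_bigr do rewrite mxE mulr_suml.
under [RHS]eq_bigr do rewrite mxE mulr_sumr.
rewrite exchange_big; apply: eq_bigr => i _; apply: eq_bigr => j _.
by rewrite mxE; ring.
Qed.

Lemma crossBl u v w : cross (u - v) w = cross u w - cross v w.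
Proof. by apply/colP => i; rewrite !mxE; ring. Qed.

Lemma crossZl a u v : cross (a *: u) v = a *: cross u v.
Proof. by apply/colP => i; rewrite !mxE; ring. Qed.

Lemma crossBr u v w : cross u (v - w) = cross u v - cross u w.
Proof. by apply/colP => i; rewrite !mxE; ring. Qed.

Lemma cross_self u : cross u u = 0.
Proof. by apply/colP => i; rewrite !mxE; ring. Qed.

Lemma dot_cross u v w : dot u (cross v w) = dot (cross u v) w.
Proof. by rewrite !dot3E !cross3E; ring. Qed.

Lemma tr_hat_mulmx w u : (hat w)^T *m u = - cross w u.
Proof.
apply/colP; apply: ord3_cases; rewrite [LHS]mxE sum3E ![_^T _ _]mxE
  ![hat _ _ _]mxE [RHS]mxE !cross3E !mxE /=; ring.
Qed.

Lemma det3E (A : 'M[R]_3) : \det A =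
  A 0 0 * (A 1 1 * A 2%:R 2%:R - A 1 2%:R * A 2%:R 1)
  - A 0 1 * (A 1 0 * A 2%:R 2%:R - A 1 2%:R * A 2%:R 0)
  + A 0 2%:R * (A 1 0 * A 2%:R 1 - A 1 1 * A 2%:R 0).
Proof.
(* With indices in nat, the nested lifts of the two expansions compute. *)
pose a m n : R := A (inord m) (inord n).
have aE i j : A i j = a i j by rewrite /a !inord_val.
rewrite (expand_det_row _ 0) sum3E /cofactor.
rewrite !(expand_det_row _ (0 : 'I_2)) !big_ord_recl !big_ord0.
rewrite /cofactor !det_mx11 !mxE.
rewrite !{}aE; clearbody a.
have -> : (2%:R : 'I_3) = 2%N :> nat by [].
by rewrite /= /bump /=; ring.
Qed.

(** The cofactor identity: it makes rotations commute with the cross product. *)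
Lemma tr_cross (g : 'M[R]_3) u v :
  g^T *m cross (g *m u) (g *m v) = \det g *: cross u v.
Proof.
have trE i w : (g^T *m w) i 0 =
    g 0 i * w 0 0 + g 1 i * w 1 0 + g 2%:R i * w 2%:R 0.
  by rewrite mxE sum3E !mxE.
have gE w i : (g *m w) i 0 =
    g i 0 * w 0 0 + g i 1 * w 1 0 + g i 2%:R * w 2%:R 0.
  by rewrite mxE sum3E.
by apply/colP; apply: ord3_cases;
  rewrite trE det3E [RHS]mxE !cross3E !gE; ring.
Qed.

Lemma SO3_cross (g : 'M[R]_3) u v :
  SO3 g -> g *m cross u v = cross (g *m u) (g *m v).
Proof.
move=> [/mulmx1C gg dg].
by rewrite -[RHS]mul1mx -gg -mulmxA tr_cross dg scale1r.
Qed.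

Lemma SO3_dot g u v : SO3 g -> dot (g *m u) (g *m v) = dot u v.
Proof. by move=> [gg _]; rewrite dot_mulmx mulmxA gg mul1mx. Qed.

Lemma gammaE g : SO3 g -> gamma g = g^T *m e3.
Proof.
move=> [gg _]; have [_ ug] := mulmx1_unit gg.
by rewrite /gamma -[invmx g]mul1mx -gg mulmxK.
Qed.

Lemma mulmx_gamma g : SO3 g -> g *m gamma g = e3.
Proof. by move=> gSO; rewrite gammaE // mulmxA (mulmx1C gSO.1) mul1mx. Qed.

Lemma dot_gamma g : SO3 g -> dot (gamma g) (gamma g) = 1.
Proof.
move=> gSO; rewrite -(SO3_dot (gamma g) (gamma g) gSO) mulmx_gamma //.
by rewrite dot3E !e3E /=; ring.
Qed.

End Algebra3.

(** * Derivatives of matrix-valued functions *)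

Section Derivatives.
Variable R : realType.
Implicit Types u v w : R -> 'cV[R]_3.

Lemma is_derive_mxP {m n : nat} (M : R -> 'M[R]_(m, n)) t dM :
  is_derive t (1 : R) M dM <->
  forall i j, is_derive t (1 : R) (fun s => M s i j) (dM i j).
Proof.
split=> [[dM' <-] i j|dM'].
  split; first exact: (derivable_mxP M t 1).1.
  by rewrite derive_mx // mxE.
have dM'' : derivable M t 1 by apply/derivable_mxP => i j; case: (dM' i j).
split=> //; rewrite derive_mx //; apply/matrixP => i j; rewrite mxE.
by case: (dM' i j).
Qed.

Lemma is_derive_mulmx {m n p : nat} (A : R -> 'M[R]_(m, n))
    (B : R -> 'M[R]_(n, p)) t dA dB :
  is_derive t (1 : R) A dA -> is_derive t (1 : R) B dB ->
  is_derive t (1 : R) (fun s => A s *m B s) (dA *m B t + A t *m dB).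
Proof.
move=> /is_derive_mxP hA /is_derive_mxP hB; apply/is_derive_mxP => i j.
rewrite (_ : (fun s => _) =
    \sum_k ((fun s => A s i k) * (fun s => B s k j))); last first.
  by apply/funext => s; rewrite mxE fct_sumE.
apply: is_derive_eq.
rewrite !mxE -big_split; apply: eq_bigr => k _ /=.
by rewrite addrC; congr (_ + _); exact: mulrC.
Qed.

Lemma is_derive_dot u v t du dv :
  is_derive t (1 : R) u du -> is_derive t (1 : R) v dv ->
  is_derive t (1 : R) (fun s => dot (u s) (v s)) (dot du (v t) + dot (u t) dv).
Proof.
move=> /is_derive_mxP hu /is_derive_mxP hv.
rewrite (_ : (fun s => _) =
    \sum_k ((fun s => u s k 0) * (fun s => v s k 0))); last first.
  by apply/funext => s; rewrite fct_sumE.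
apply: is_derive_eq.
rewrite /dot -big_split; apply: eq_bigr => k _ /=.
by rewrite addrC; congr (_ + _); exact: mulrC.
Qed.

Lemma is_derive_cross u v t du dv :
  is_derive t (1 : R) u du -> is_derive t (1 : R) v dv ->
  is_derive t (1 : R) (fun s => cross (u s) (v s))
    (cross du (v t) + cross (u t) dv).
Proof.
move=> /is_derive_mxP hu /is_derive_mxP hv; apply/is_derive_mxP => i j.
rewrite (ord1 j) {j} (_ : (fun s => _) =
    (fun s => u s (i + 1) 0) * (fun s => v s (i + 2%:R) 0)
    - (fun s => u s (i + 2%:R) 0) * (fun s => v s (i + 1) 0)); last first.
  by apply/funext => s; rewrite mxE.
apply: is_derive_eq.
rewrite !mxE /GRing.scale /=; ring.
Qed.

Lemma derive0_const_ge0 (f : R -> R) :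
  (forall t : R, 0 <= t -> is_derive t (1 : R) f 0) ->
  forall t, 0 <= t -> f t = f 0.
Proof.
move=> df t t0.
have [||c _] := @MVT_segment R f (cst 0) 0 t t0.
- by move=> s; rewrite in_itv /= => /andP[/ltW s0 _]; exact: df.
- apply: continuous_in_subspaceT => s; rewrite inE /= in_itv /= => /andP[s0 _].
  have ds := df _ s0.
  by apply: differentiable_continuous; apply/derivable1_diffP.
- by rewrite mul0r => /subr0_eq.
Qed.

End Derivatives.

(** * Bounded functions and the limsup at infinity *)

Section Bounded.
Variable R : realType.
Implicit Types (u v : 'cV[R]_3) (A : 'M[R]_3).

Lemma limf_esup_pinfty_bounded (f : R -> R) :
  limf_esup (fun t => (f t)%:E) +oo <> +oo%E ->
  exists C T, forall t, T < t -> f t <= C.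
Proof.
rewrite limf_esupE; apply: contra_notP => nbd.
apply/eqP; rewrite -leye_eq; apply: le_ereal_inf_tmp => _ [V [T [_ TV]] <-].
rewrite leye_eq; apply/eqP/eq_infty => C.
have [t Tt Ct] : exists2 t, T < t & C < f t.
  apply: contrapT => nt; apply: nbd; exists C, T => t Tt.
  by rewrite leNgt; apply/negP => Ct; apply: nt; exists t.
rewrite (le_trans (ltW (_ : C%:E < (f t)%:E)%E)) ?lte_fin //.
by rewrite ereal_sup_ubound //; exists t => //; exact: TV.
Qed.

Lemma normr_entry {m n : nat} (A : 'M[R]_(m, n)) i j : `|A i j| <= `|A|.
Proof.
by rewrite [leRHS]/Num.norm /= mx_normrE; exact: (le_bigmax _ _ (i, j)).
Qed.

Lemma normr_mx_le {m n : nat} (A : 'M[R]_(m, n)) c :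
  0 <= c -> (forall i j, `|A i j| <= c) -> `|A| <= c.
Proof.
by move=> c0 h; rewrite [leLHS]/Num.norm /= mx_normrE bigmax_le // => -[i j] _.
Qed.

Lemma sum3_const (c : R) : \sum_(i < 3) c = 3 * c.
Proof. by rewrite sum3E; ring. Qed.

Lemma normr_dot_le u v : `|dot u v| <= 3 * `|u| * `|v|.
Proof.
rewrite -mulrA -sum3_const (le_trans (ler_norm_sum _ _ _)) // ler_sum // => i _.
by rewrite normrM ler_pM // normr_entry.
Qed.

Lemma normr_cross_le u v : `|cross u v| <= 2 * `|u| * `|v|.
Proof.
apply: normr_mx_le => [|i j]; first by rewrite !mulr_ge0.
rewrite mxE (le_trans (ler_normB _ _)) // !normrM -mulrA (mulr_natl _ 2) mulr2n.
by rewrite lerD // ler_pM // normr_entry.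
Qed.

Lemma normr_mulmx_le A u : `|A *m u| <= 3 * `|A| * `|u|.
Proof.
apply: normr_mx_le => [|i j]; first by rewrite !mulr_ge0.
rewrite mxE -mulrA -sum3_const (le_trans (ler_norm_sum _ _ _)) // ler_sum //.
move=> k _.
by rewrite normrM ler_pM // normr_entry.
Qed.

Lemma normr_enorm u : `|u| <= enorm u.
Proof.
apply: normr_mx_le => [|i j]; first exact: sqrtr_ge0.
rewrite (ord1 j) -sqrtr_sqr ler_wsqrtr // /dot (bigD1 i) //= -expr2 lerDl.
by apply: sumr_ge0 => k _; rewrite -expr2 sqr_ge0.
Qed.

Lemma bounded_le {V W : normedModType R} (S : set R) (f : R -> W) (a : R -> V) :
  (forall t, S t -> `|f t| <= `|a t|) ->
  [bounded a t | t in S] -> [bounded f t | t in S].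
Proof.
move=> fa [M [Mr aM]]; exists M; split=> // N MN t St.
exact: le_trans (fa _ St) (aM _ MN _ St).
Qed.

(** Covers every bilinear operation, such as scaling, [dot], [cross] and
    [mulmx]. *)
Lemma bounded_le_mul {U V W : normedModType R} (S : set R) (c : R)
    (f : R -> W) (a : R -> U) (b : R -> V) :
  (forall t, S t -> `|f t| <= c * `|a t| * `|b t|) ->
  [bounded a t | t in S] -> [bounded b t | t in S] -> [bounded f t | t in S].
Proof.
move=> fab [Ma [_ aM]] [Mb [_ bM]].
exists (`|c| * (`|Ma| + 1) * (`|Mb| + 1)); split; first exact: num_real.
move=> M ltM t St; apply: le_trans (ltW ltM); apply: le_trans (fab _ St) _.
have la : `|a t| <= `|Ma| + 1 by apply: aM => //; rewrite ltr_pwDr // ler_norm.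
have lb : `|b t| <= `|Mb| + 1 by apply: bM => //; rewrite ltr_pwDr // ler_norm.
apply: (@le_trans _ _ (`|c| * `|a t| * `|b t|)).
  by do 2! rewrite ler_wpM2r //; exact: ler_norm.
by rewrite !ler_pM ?mulr_ge0.
Qed.

Lemma bounded_le_add {U V W : normedModType R} (S : set R)
    (f : R -> W) (a : R -> U) (b : R -> V) :
  (forall t, S t -> `|f t| <= `|a t| + `|b t|) ->
  [bounded a t | t in S] -> [bounded b t | t in S] -> [bounded f t | t in S].
Proof.
move=> fab [Ma [_ aM]] [Mb [_ bM]].
exists ((`|Ma| + 1) + (`|Mb| + 1)); split; first exact: num_real.
move=> M ltM t St; apply: le_trans (ltW ltM); apply: le_trans (fab _ St) _.
by apply: lerD; [apply: aM|apply: bM] => //; rewrite ltr_pwDr // ler_norm.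
Qed.

Lemma bounded_segment {V : normedModType R} (x : R -> V) (a b : R) :
  (forall t, a <= t -> {for t, continuous x}) ->
  [bounded x t | t in [set` `[a, b]]].
Proof.
move=> xc.
have cx : compact (x @` [set` `[a, b]]).
  apply: continuous_compact; last exact: segment_compact.
  apply: continuous_in_subspaceT => t; rewrite inE /= in_itv /= => /andP[at_ _].
  exact: xc.
have [M [Mr xM]] := compact_bounded cx.
by exists M; split=> // N MN t tab; apply: xM MN _ _; exists t.
Qed.

Lemma bounded_union {V : normedModType R} (x : R -> V) (S S' U : set R) :
  U `<=` S `|` S' ->
  [bounded x t | t in S] -> [bounded x t | t in S'] ->
  [bounded x t | t in U].
Proof.
move=> USS bS bS'.
apply: filterS2 bS bS' => M MS MS' t /USS[]; [exact: MS|exact: MS'].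
Qed.

End Bounded.

(** * The moving energy *)

Section MovingEnergy.
Variable R : realType.
Implicit Types (u v w x : 'cV[R]_3) (g A : 'M[R]_3).
Local Notation e3 := (@e3 R).

(** The velocity of the center of mass relative to the plane is that of a body
    rolling on a plane at rest with the relative angular velocity
    [w - kappa gamma]. *)
Lemma rolling_velocityE Ginv kappa x g w : SO3 g ->
  rolling_velocity Ginv kappa x g w =
  g *m cross (w - kappa *: gamma g) (rho Ginv g) + kappa *: cross e3 x.
Proof.
move=> gSO; rewrite /rolling_velocity crossBl crossZl mulmxBr -scalemxAr.
rewrite (SO3_cross (gamma g)) // mulmx_gamma // crossBr scalerBr.
by rewrite addrA addrAC.
Qed.

(** The relative angular velocity [w - kappa gamma] is an admissible test
    vector for [ideal_reaction], so the reaction has no power relative to the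
    plane: its power on the motion is [kappa] times its moment about the
    vertical axis through the origin. *)
Lemma ideal_power Ginv kappa x g w R1 R2 :
  SO3 g -> ideal_reaction Ginv g R1 R2 ->
  dot R1 (rolling_velocity Ginv kappa x g w) + dot R2 w =
  kappa * (dot R1 (cross e3 x) + dot R2 (gamma g)).
Proof.
move=> gSO /(_ (w - kappa *: gamma g)).
rewrite rolling_velocityE // !dotDr -scaleNr !dotZr => h.
apply/eqP; rewrite -subr_eq0 -h; apply/eqP; ring.
Qed.

(** The total energy minus [kappa] times the vertical component of the total
    angular momentum about the origin. The Poisson vector is written
    [g^T *m e3], which is linear in [g], so that it can be differentiated
    without inverting matrices near the given time. *)
Definition moving_energy (m grav kappa : R) A x v g w : R :=
  2^-1 * (dot (A *m w) w + m * dot v v) + m * grav * x 2%:R 0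
  - kappa * (dot (A *m w) (g^T *m e3) + m * dot e3 (cross x v)).

(** Newton's equation eliminates the acceleration and Euler's equation the
    angular acceleration; the gravity terms cancel, and what is left of the
    derivative is the identity [ideal_power]. *)
Lemma moving_energy_conserved Ginv (m grav kappa : R) A (x v w : R -> 'cV[R]_3)
    (g : R -> 'M[R]_3) (R1 R2 a dw : 'cV[R]_3) t :
  A^T = A -> SO3 (g t) -> ideal_reaction Ginv (g t) R1 R2 ->
  v t = rolling_velocity Ginv kappa (x t) (g t) (w t) ->
  is_derive t (1 : R) x (v t) -> is_derive t (1 : R) v a ->
  is_derive t (1 : R) g (g t *m hat (w t)) -> is_derive t (1 : R) w dw ->
  m *: a = - (m * grav) *: e3 + R1 ->
  A *m dw = cross (A *m w t) (w t) + R2 ->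
  is_derive t (1 : R)
    (fun s => moving_energy m grav kappa A (x s) (v s) (g s) (w s)) 0.
Proof.
move=> symA gSO ideal vt dx dv dg dW newton euler.
have dAw : is_derive t (1 : R) (fun s => A *m w s) (A *m dw).
  by have := is_derive_mulmx (is_derive_cst A t 1) dW; rewrite mul0mx add0r.
have dgamma : is_derive t (1 : R) (fun s => (g s)^T *m e3)
    (- cross (w t) (gamma (g t))).
  have dgT : is_derive t (1 : R) (fun s => (g s)^T) ((hat (w t))^T *m (g t)^T).
    apply/is_derive_mxP => i j; rewrite -trmx_mul mxE.
    rewrite (_ : (fun s => _) = (fun s => g s j i)); last first.
      by apply/funext => s; rewrite mxE.
    by move/is_derive_mxP: dg.
  have := is_derive_mulmx dgT (is_derive_cst e3 t 1).
  by rewrite mulmx0 addr0 -mulmxA -gammaE // tr_hat_mulmx.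
have dspin := is_derive_dot dAw dgamma.
have dorb := is_derive_dot (is_derive_cst e3 t 1) (is_derive_cross dx dv).
have drot := is_derive_dot dAw dW.
have dtrans := is_derive_dot dv dv.
have dheight := (is_derive_mxP _ _ _).1 dx 2%:R 0.
have D := is_deriveB
  (is_deriveD (is_deriveZ 2^-1 (is_deriveD drot (is_deriveZ m dtrans)))
              (is_deriveZ (m * grav) dheight))
  (is_deriveZ kappa (is_deriveD dspin (is_deriveZ m dorb))).
refine (is_derive_eq D _); rewrite /GRing.scale /=.
have power := ideal_power kappa (x t) (w t) gSO ideal.
have rotE : dot (A *m w t) dw = dot (A *m dw) (w t).
  by rewrite dot_mulmx symA dotC.
have momE : dot (A *m dw) (w t) = dot R2 (w t).
  by rewrite euler dotDl -dot_cross cross_self (dotC _ 0) dot0l add0r.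
have newtonE : m * dot a (v t) = - (m * grav) * v t 2%:R 0 + dot R1 (v t).
  rewrite -dotZl newton dotDl dotZl; congr (_ * _ + _).
  by rewrite dot3E !e3E /=; ring.
have spinE : dot (A *m dw) ((g t)^T *m e3)
    + dot (A *m w t) (- cross (w t) (gamma (g t))) = dot R2 (gamma (g t)).
  rewrite -gammaE // euler dotDl -dot_cross -scaleN1r dotZr; ring.
have orbE : m * dot e3 (cross (v t) (v t) + cross (x t) a) =
    dot R1 (cross e3 (x t)).
  rewrite cross_self add0r -dotZr.
  have -> : m *: cross (x t) a = cross (x t) (m *: a).
    by apply/colP => i; rewrite !mxE; ring.
  by rewrite newton !dot3E !cross3E !mxE /=; ring.
rewrite rotE momE spinE (dotC (v t) a).
rewrite dot0l add0r orbE.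
have -> : m * (dot a (v t) + dot a (v t)) = 2 * (m * dot a (v t)) by ring.
rewrite newtonE -vt in power *.
lra.
Qed.

Lemma moving_energy_motion Ginv (m grav kappa : R) II
    (J : interval R) (x : R -> 'cV[R]_3) (g : R -> 'M[R]_3) Om :
  II^T = II -> is_motion Ginv m grav kappa II J x g Om ->
  forall t, t \in J -> is_derive t (1 : R)
    (fun s => moving_energy m grav kappa II (x s) (derive1 x s) (g s) (Om s)) 0.
Proof.
move=> symII [att _ kin roll dyn] t tJ.
have [R1 [R2 [ideal dx' dOm newton euler]]] := dyn t tJ.
have dOm' := derivableP dOm.
have x'E : derive1 x t = rolling_velocity Ginv kappa (x t) (g t) (Om t).
  by rewrite derive1E; have [] := roll t tJ.
have dx : is_derive t (1 : R) x (derive1 x t) by rewrite x'E; exact: roll.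
have dv : is_derive t (1 : R) (derive1 x) (derive1 (derive1 x) t).
  by rewrite (derive1E (derive1 x)); exact: (derivableP dx').
have dM : derive1 (fun s => II *m Om s) t = II *m 'D_1 Om t.
  have [_] := is_derive_mulmx (is_derive_cst II t 1) dOm'.
  by rewrite mul0mx add0r derive1E.
rewrite dM in euler.
exact: (@moving_energy_conserved Ginv m grav kappa II x (derive1 x) Om g R1 R2
  _ _ t symII (att t tJ) ideal x'E dx dv (kin t tJ) dOm' newton euler).
Qed.

(** With [v = p + kappa *: cross e3 x], where [p] is the velocity relative to
    the plane, the terms linear in [p] of [m * dot v v / 2] and of
    [kappa * m * dot e3 (cross x v)] cancel, leaving the kinetic energy of [p]
    and the centrifugal potential. *)
Lemma moving_energy_rolling Ginv (m grav kappa : R) A x g w : SO3 g ->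
  moving_energy m grav kappa A x (rolling_velocity Ginv kappa x g w) g w =
  2^-1 * (dot (A *m w) w
          + m * (dot (cross (w - kappa *: gamma g) (rho Ginv g))
                     (cross (w - kappa *: gamma g) (rho Ginv g))))
  + m * grav * x 2%:R 0 - kappa * dot (A *m w) (gamma g)
  - 2^-1 * m * kappa ^+ 2 * (x 0 0 ^+ 2 + x 1 0 ^+ 2).
Proof.
move=> gSO; rewrite /moving_energy -gammaE // rolling_velocityE //.
set q := cross _ (rho _ _); rewrite -(SO3_dot q q gSO).
have velE (p c : 'cV[R]_3) i : (p + kappa *: c) i 0 = p i 0 + kappa * c i 0.
  by rewrite !mxE.
move: (g *m q) => p; rewrite !dot3E !cross3E !velE !cross3E !mxE /=.
by field.
Qed.

Lemma rho_bounded K (G Ginv : 'cV[R]_3 -> 'cV[R]_3) : compact K ->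
  diffeomorphism (boundary K) (@sphere R) G Ginv ->
  exists r, forall g, SO3 g -> `|rho Ginv g| <= r.
Proof.
move=> cK [_ _ GinvK _ _].
have [M [_ KM]] := compact_bounded cK.
exists (M + 1) => g gSO; rewrite normrN; apply: KM; first by rewrite ltrDl.
have /GinvK[+ _] : sphere (- gamma g).
  rewrite /sphere /= /enorm -scaleN1r dotZl dotZr dot_gamma //.
  by rewrite mulrA mulrNN !mulr1 sqrtr1.
rewrite -(closure_id K).1 //; apply: compact_closed => //.
Qed.

(** Solving [moving_energy_rolling] for [x1^2 + x2^2] expresses it by
    quantities that are bounded when the angular velocity is. *)
Lemma bounded_moving_energy Ginv (m grav kappa c : R) A (S : set R)
    (x w : R -> 'cV[R]_3) (g : R -> 'M[R]_3) : 0 < m -> kappa != 0 ->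
  (forall t, S t -> SO3 (g t)) ->
  (forall t, S t -> x t 2%:R 0 = dot (gamma (g t)) (rho Ginv (g t))) ->
  (forall t, S t -> moving_energy m grav kappa A (x t)
     (rolling_velocity Ginv kappa (x t) (g t) (w t)) (g t) (w t) = c) ->
  [bounded rho Ginv (g t) | t in S] -> [bounded w t | t in S] ->
  [bounded x t | t in S].
Proof.
move=> m0 k0 gSO contact energy brho bw.
have bgamma : [bounded gamma (g t) | t in S].
  exists 1; split; first exact: num_real.
  move=> M M1 t St; apply: le_trans (ltW M1); apply: le_trans (normr_enorm _) _.
  by rewrite /enorm dot_gamma ?sqrtr1 //; exact: gSO.
have bdot (a b : R -> 'cV[R]_3) :
    [bounded a t | t in S] -> [bounded b t | t in S] ->
    [bounded (dot (a t) (b t) : R) | t in S].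
  by apply: (bounded_le_mul (c := 3)) => t _; exact: normr_dot_le.
have bAw : [bounded A *m w t | t in S].
  apply: (bounded_le_mul (c := 3)) (bounded_cst A S) bw => t _.
  exact: normr_mulmx_le.
have bscale (V : normedModType R) (k : R) (a : R -> V) :
    [bounded a t | t in S] -> [bounded k *: a t | t in S].
  move=> ba; apply: (bounded_le_mul (c := 1)) (bounded_cst k S) ba => t _.
  by rewrite mul1r normrZ.
have badd (V : normedModType R) (a b : R -> V) :
    [bounded a t | t in S] -> [bounded b t | t in S] ->
    [bounded a t + b t | t in S].
  by apply: bounded_le_add => t _; exact: ler_normD.
pose q t := cross (w t - kappa *: gamma (g t)) (rho Ginv (g t)).
have bq : [bounded q t | t in S].
  have bu : [bounded w t - kappa *: gamma (g t) | t in S].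
    apply: (badd) => //.
    apply: (bounded_le_mul (c := 1)) (bounded_cst kappa S) bgamma => t _.
    by rewrite mul1r normrN normrZ.
  apply: (bounded_le_mul (c := 2)) bu brho => t _; exact: normr_cross_le.
have bx2 : [bounded (x t 2%:R 0 : R) | t in S].
  by apply: bounded_le (bdot _ _ bgamma brho) => t St; rewrite contact.
pose h t := x t 0 0 ^+ 2 + x t 1 0 ^+ 2.
have bh : [bounded (h t : R) | t in S].
  have : [bounded ((2 / (m * kappa ^+ 2)) *:
      (2^-1 *: (dot (A *m w t) (w t) + m *: (dot (q t) (q t) : R))
       + (m * grav) *: (x t 2%:R 0 : R)
       + (- kappa) *: (dot (A *m w t) (gamma (g t)) : R) + (- c)) : R)
    | t in S].
    apply: (bscale); apply: (badd); last exact: bounded_cst.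
    apply: (badd); last by apply: (bscale); exact: (bdot).
    apply: (badd); last exact: (bscale).
    apply: (bscale); apply: (badd); first exact: (bdot).
    by apply: (bscale); exact: (bdot).
  apply: bounded_le => t St; rewrite -(energy t St).
  rewrite moving_energy_rolling; last exact: gSO.
  rewrite /GRing.scale /= -/(q t) le_eqVlt; apply/orP; left; apply/eqP.
  congr `|_|.
  by rewrite /h; field; rewrite k0 gt_eqF.
(* The constant 1 serves in the bound |y| <= y^2 + 1 of each coordinate. *)
apply: (bounded_le_add (a := fun t => (h t + 1 : R))) bx2 => [t St|];
  last first.
  by apply: (badd) => //; exact: bounded_cst.
have sq_le (y z : R) : `|y| <= `|y ^+ 2 + z ^+ 2 + 1|.
  rewrite [leRHS]ger0_norm ?addr_ge0 ?sqr_ge0 //.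
  by rewrite ler_norml; apply/andP; split; nra.
apply: normr_mx_le => [|i j]; first by rewrite addr_ge0.
rewrite (ord1 j); move: i; apply: ord3_cases.
- by apply: ler_wpDr => //; exact: sq_le.
- apply: ler_wpDr => //; rewrite /h addrC [_ ^+ 2 + _]addrC addrC.
  exact: sq_le.
- by apply: ler_wpDl.
Qed.

End MovingEnergy.

Theorem corollary16 (R : realType)
    (K : set 'cV[R]_3) (G Ginv : 'cV[R]_3 -> 'cV[R]_3)
    (HK : smooth_convex_body K) (HG : is_Gauss_map K G)
    (HGdiff : diffeomorphism (boundary K) (@sphere R) G Ginv)
    (m grav kappa : R) (II : 'M[R]_3)
    (Hm : 0 < m) (Hgrav : 0 < grav) (Hkappa : kappa != 0) (HII : posdef II)
    (J : interval R) (HJopen : open [set` J])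
    (HJ : [set` `[0, +oo[] `<=` [set` J])
    (x : R -> 'cV[R]_3) (g : R -> 'M[R]_3) (Om : R -> 'cV[R]_3)
    (Hmot : is_motion Ginv m grav kappa II J x g Om)
    (Hunbounded : ~ [bounded x t | t in [set` `[0, +oo[]]) :
  limf_esup (fun t : R => (enorm (Om t))%:E) +oo = +oo%E.
Proof.
apply: contrapT => /limf_esup_pinfty_bounded[C [T OmC]]; apply: Hunbounded.
have J0 t : 0 <= t -> t \in J by move=> t0; apply: HJ; rewrite /= in_itv /= t0.
have [att contact kin roll dyn] := Hmot.
have dE := moving_energy_motion HII.1 Hmot.
(* Conservation starts at time 0 and the bound on Om after T, which may be
   negative. *)
pose S := [set t | `|T| < t].
have S0 t : S t -> 0 <= t by move=> /ltW; exact: le_trans.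
have late : [bounded x t | t in S].
  have [cK _ _ _] := HK; have [r rhor] := rho_bounded cK HGdiff.
  pose c := moving_energy m grav kappa II (x 0) (derive1 x 0) (g 0) (Om 0).
  apply: (@bounded_moving_energy _ Ginv m grav kappa c II S x Om g) => //.
  - by move=> t /S0/J0; exact: att.
  - by move=> t /S0/J0; exact: contact.
  - move=> t /S0 t0.
    have -> : rolling_velocity Ginv kappa (x t) (g t) (Om t) = derive1 x t.
      by rewrite derive1E; have [_ ->] := roll t (J0 t t0).
    exact: (derive0_const_ge0 (fun s s0 => dE s (J0 s s0)) t0).
  - exists r; split=> [|M rM t /S0/J0/att/rhor]; first exact: num_real.
    by move=> /le_trans; apply; exact: ltW.
  - exists C; split=> [|M CM t St]; first exact: num_real.
    apply: le_trans (normr_enorm _) _; apply: le_trans (ltW CM).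
    by apply: OmC; apply: le_lt_trans St; exact: ler_norm.
apply: bounded_union late (@bounded_segment _ _ x 0 `|T| _) => [t|t t0].
  rewrite /= !in_itv /= andbT => t0.
  by have [tT|Tt] := leP t `|T|; [right; rewrite /= ?in_itv /= t0|left].
have dx := roll t (J0 t t0).
by apply: differentiable_continuous; apply/derivable1_diffP.
Qed.
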